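(* Let $g_A$ be a grading on $Q_A$ such that $\omega_A$ is homogeneous of degree $a$ and the morphism of quivers $\Phi\colon Q_A\to\tilde Q_G$ is $g_A$-gradable. Then there exists a grading $g_G$ on $Q_G$ such that $\omega_G$ is homogeneous of degree $a$ with respect to it.
   Context: Gradings. A grading on a quiver $Q$ is a map $g$ from its set of arrows to $\mathbb Z$; it induces a grading of the path algebra (vertices in degree $0$, degree of a path = sum of degrees of its arrows). A morphism of quivers $\phi\colon Q\to Q'$ is $g$-gradable if for every arrow $b$ of $Q'$ all arrows in $\phi^{-1}(b)$ have the same $g$-degree (or $\phi^{-1}(b)=\varnothing$). Group. Let $m,r,s,t$ be positive integers with $\gcd(m,r)=1$; $r^s\equiv 1\pmod m$; $(r-1)t\equiv 0\pmod m$; $s$ prime; $r\not\equiv 1\pmod m$. Write $\epsilon_k$ for a fixed primitive $k$-th root of unity. $G\le\mathrm{GL}(s,\mathbb C)$ is generated by $\alpha=\mathrm{diag}(\epsilon_m,\epsilon_m^r,\dots,\epsilon_m^{r^{s-1}})$ and $\beta$, where $\beta e_k=e_{k+1}$ for $1\le k\le s-1$ and $\beta e_s=\epsilon_m^te_1$. $A=\langle\alpha\rangle$ is normal, cyclic of order $m$, and $G/A$ is cyclic of order $s$ generated by the class of $\beta$. Put $c=\sum_{k=0}^{s-1}r^k$ and $V=\mathbb C^s$ (natural representation). Representations. $S_i=\mathbb Cv_i$ ($i\in\mathbb Z/m\mathbb Z$) is the representation of $A$ with $\alpha v_i=\epsilon_m^iv_i$; $T_i=\mathrm{Ind}_A^G(S_i)$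 has basis $v_i,\beta v_i,\dots,\beta^{s-1}v_i$ (with $\beta^sv_i=\epsilon_m^{ti}v_i$); $V=T_1$. $G/A$ acts on $\mathbb Z/m\mathbb Z$ by $i\mapsto ri$; $\mathcal F$ is the set of fixed points and $\mathcal D\supseteq\mathcal F$ a fixed set of representatives of the orbits, assumed closed under $i\mapsto i+c$. For $i\in\mathcal F$, $0\le\ell\le s-1$: $\eta_i$ is a fixed $s$-th root of $\epsilon_m^{ti}$, $\lambda_{i,\ell}=\eta_i\epsilon_s^\ell$, $w_i^{(\ell)}=\sum_{k=0}^{s-1}\lambda_{i,\ell}^{s-1-k}\beta^kv_i$, $T_i^{(\ell)}=\mathbb Cw_i^{(\ell)}$, and $T_i=\bigoplus_\ell T_i^{(\ell)}$. The irreducible representations of $G$ are $T_i$ ($i\in\mathcal D\smallsetminus\mathcal F$) and $T_i^{(\ell)}$ ($i\in\mathcal F$). $Q_A$. Vertices $\mathbb Z/m\mathbb Z$, arrows $x_q^i\colon i\to i-r^q$ for $0\le q\le s-1$. $\omega_A=\sum_i\sum_{\sigma\in\mathfrak S_s}(-1)^\sigma\mathbf p^i_\sigma$, where $\mathfrak S_s$ is the symmetric group on $\{0,\dots,s-1\}$ and $\mathbf p_\sigma^i$ is the path starting at $i$ and running successively through arrows of type $x_{\sigma(0)},x_{\sigma(1)},\dots,x_{\sigma(s-1)}$. $Q_G$. Vertices $i$ (for $T_i$, $i\in\mathcal D\smallsetminus\mathcal F$) and $i^{(\ell)}$ (for $T_i^{(\ell)}$, $i\in\mathcal F$). Arrows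 (indices $p,a\in\{0,\dots,s-1\}$, read modulo $s$): (1) for $i,j\in\mathcal D\smallsetminus\mathcal F$, $x^i_{p,a}\colon i\to j$ whenever $r^aj\equiv i-r^p$, representing the $G$-map $T_i\to V\otimes T_j$, $v_i\mapsto\beta^pv_1\otimes\beta^av_j$; (2) for $i\in\mathcal D\smallsetminus\mathcal F$, $j\in\mathcal F$, $x^{i(\ell)}_{p,0}\colon i\to j^{(\ell)}$ whenever $j\equiv i-r^p$, representing the map $T_i\to V\otimes T_j$, $v_i\mapsto\beta^pv_1\otimes v_j$, followed by the projection $V\otimes T_j\to V\otimes T_j^{(\ell)}$; (3) for $i\in\mathcal F$, $j\in\mathcal D\smallsetminus\mathcal F$, $x^{(\ell)i}_{p,0}\colon i^{(\ell)}\to j$ whenever $j\equiv i-r^p$, representing the restriction to $T_i^{(\ell)}$ of $T_i\to V\otimes T_j$, $v_i\mapsto\beta^pv_1\otimes v_j$. There are no arrows between vertices coming from $\mathcal F$. (So arrows $S\to T$ form a basis of $\mathrm{Hom}_G(S,V\otimes T)$.) $\omega_G$. For a path $p\colon S_1\xrightarrow{a_1}S_2\to\cdots\xrightarrow{a_s}S_{s+1}$ in $Q_G$, the composition $S_1\to V\otimes S_2\to\cdots\to V^{\otimes s}\otimes S_{s+1}\to\bigwedge^sV\otimes S_{s+1}$ (last map the antisymmetrizer $x_1\otimes\cdots\otimes x_s\mapsto x_1\wedge\cdots\wedge x_s$ tensored with the identity) is, after identifying $\bigwedge^sV\otimes S_{s+1}=\det_V\otimes S_{s+1}$ with an element of $\mathrm{Irr}(G)$,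 multiplication by a scalar $c_p$; $\omega_G=\sum_pc_p\dim(S_{s+1})p$, over paths of length $s$. $\tilde Q_G$. Vertices $\mathcal D$; arrows: for $i,j\in\mathcal D\smallsetminus\mathcal F$ the same $x^i_{p,a}$ as in $Q_G$; for exactly one of $i,j$ in $\mathcal F$, an arrow $x^i_{p,0}\colon i\to j$ whenever $j\equiv i-r^p$ for some $p$. $\Phi\colon Q_A\to\tilde Q_G$. For $i\in\mathbb Z/m\mathbb Z$ let $\underline i\in\mathcal D$ be the representative of its orbit and $\kappa_i\in\{0,\dots,s-1\}$ with $r^{\kappa_i}\underline i\equiv i$ (unique if $i\notin\mathcal F$; $\kappa_i:=0$ if $i\in\mathcal F$). $\Phi(i)=\underline i$ and $\Phi(x^i_q)=x^{\underline i}_{p,a}\colon \underline i\to\underline{i-r^q}$, where $(p,a)=(q-\kappa_i,\kappa_{i-r^q}-\kappa_i)$ if $\underline i,\underline{i-r^q}\notin\mathcal F$; $(p,a)=(q-\kappa_i,0)$ if $\underline i\notin\mathcal F$, $\underline{i-r^q}\in\mathcal F$; $(p,a)=(q-\kappa_{i-r^q},0)$ if $\underline i\in\mathcal F$, $\underline{i-r^q}\notin\mathcal F$. *)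

(* Defs.v *)
From HB Require Import structures.
From mathcomp Require Import all_boot all_order all_fingroup all_algebra.
From mathcomp Require Import boolp classical_sets.
From mathcomp Require Export reals complex.

Set Implicit Arguments.
Unset Strict Implicit.
Unset Printing Implicit Defensive.

Import GRing.Theory.
Local Open Scope ring_scope.

Record quiver := Quiver {
  vertex : finType;
  arrow : finType;
  source : arrow -> vertex;
  target : arrow -> vertex }.

Record quiver_morphism (Q Q' : quiver) := QuiverMorphism {
  on_vertex : vertex Q -> vertex Q';
  on_arrow : arrow Q -> arrow Q';
  on_source : forall x, source (on_arrow x) = on_vertex (source x);
  on_target : forall x, target (on_arrow x) = on_vertex (target x) }.

(* Arrows are listed in the order in which the path runs through them. *)
Fixpoint composable (Q : quiver) (v : vertex Q) (bs : seq (arrow Q)) : bool :=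
  if bs is b :: bs' then (source b == v) && composable (target b) bs' else true.

Record qpath (Q : quiver) (n : nat) := QPath {
  path_data : vertex Q * n.-tuple (arrow Q);
  path_composable : composable path_data.1 path_data.2 }.

HB.instance Definition _ (Q : quiver) (n : nat) := [isSub for @path_data Q n].
HB.instance Definition _ (Q : quiver) (n : nat) := [Finite of qpath Q n by <:].

Definition path_start (Q : quiver) (n : nat) (p : qpath Q n) : vertex Q :=
  (path_data p).1.
Definition path_arrows (Q : quiver) (n : nat) (p : qpath Q n) : n.-tuple (arrow Q) :=
  (path_data p).2.
Definition path_end (Q : quiver) (n : nat) (p : qpath Q n) : vertex Q :=
  last (path_start p) [seq target b | b <- path_arrows p].

(* Elements of the path algebra that are combinations of paths of length n. *)
Definition path_comb (K : fieldType) (Q : quiver) (n : nat) := {ffun qpath Q n -> K}.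

Definition grading (Q : quiver) := arrow Q -> int.

Definition path_degree (Q : quiver) (g : grading Q) (n : nat) (p : qpath Q n) : int :=
  \sum_(b <- path_arrows p) g b.

Definition homogeneous (K : fieldType) (Q : quiver) (n : nat) (g : grading Q)
    (omega : path_comb K Q n) (a : int) : Prop :=
  forall p, omega p != 0 -> path_degree g p = a.

Definition gradable (Q Q' : quiver) (g : grading Q) (phi : quiver_morphism Q Q') : Prop :=
  forall (b : arrow Q') (x y : arrow Q),
    on_arrow phi x = b -> on_arrow phi y = b -> g x = g y.

Definition fixed_residues (m r : nat) : {set 'Z_m} := [set i | r%:R * i == i].

(* The conditions force m, s >= 2, so that 'Z_m and 'Z_s are Z/m and Z/s. *)
Record metacyclic (C : fieldType) := Metacyclic {
  m : nat;
  r : nat;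
  s : nat;
  t : nat;
  m_gt0 : (0 < m)%N;
  r_gt0 : (0 < r)%N;
  t_gt0 : (0 < t)%N;
  coprime_m_r : coprime m r;
  r_exp_s : (r ^ s = 1 %[mod m])%N;
  r1_mul_t : ((r - 1) * t = 0 %[mod m])%N;
  s_prime : prime s;
  r_neq1 : (r <> 1 %[mod m])%N;
  eps_m : C;
  eps_m_prim : m.-primitive_root eps_m;
  eps_s : C;
  eps_s_prim : s.-primitive_root eps_s;
  reps : {set 'Z_m};
  fixed_sub_reps : fixed_residues m r \subset reps;
  reps_transversal : forall i : 'Z_m,
    exists! d : 'Z_m, d \in reps /\ exists k : nat, i = r%:R ^+ k * d;
  reps_shift : forall i : 'Z_m, i \in reps -> i + \sum_(k < s) r%:R ^+ k \in reps;
  eta : 'Z_m -> C;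
  eta_root : forall i : 'Z_m, i \in fixed_residues m r -> eta i ^+ s = eps_m ^+ (t * i) }.

Arguments eta {C} m i.

Section Metacyclic.

Context (C : fieldType) (X : metacyclic C).

Local Notation m := (m X).
Local Notation r := (r X).
Local Notation s := (s X).
Local Notation t := (t X).
Local Notation eps_m := (eps_m X).
Local Notation eps_s := (eps_s X).
Local Notation D := (reps X).
Local Notation F := (fixed_residues m r).

Definition rpow (k : 'Z_s) : 'Z_m := r%:R ^+ k.

(* The representation T_i on row vectors, in the basis v_i, beta v_i, ...,
   beta^(s-1) v_i. Matrices act on the right, and a representation of G is
   recorded by the action of the generators alpha and beta of G. Since
   alpha beta = beta alpha^r, beta^k v_i has weight i r^k under alpha. *)
Definition alphaT (i : 'Z_m) : 'M[C]_s :=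
  diag_mx (\row_(k < s) eps_m ^+ (i * r ^ k)).

Definition betaT (i : 'Z_m) : 'M[C]_s :=
  \matrix_(k < s, l < s)
    if k.+1 == s then (l == 0 :> nat)%:R * eps_m ^+ (t * i) else (l == k.+1 :> nat)%:R.

Definition vT : 'rV[C]_s := \row_(k < s) (k == 0 :> nat)%:R.

(* The natural representation V is T_1. *)
Definition alphaV : 'M[C]_s := alphaT 1.
Definition betaV : 'M[C]_s := betaT 1.

Definition lambda (i : 'Z_m) (l : 'Z_s) : C := eta X i * eps_s ^+ l.

Definition wT (i : 'Z_m) (l : 'Z_s) : 'rV[C]_s :=
  \sum_(k < s) lambda i l ^+ (s - 1 - k) *: (vT *m betaT i ^+ k).

(* The projection of T_i onto the line T_i^(l) along the other lines T_i^(l'). *)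
Definition projT (i : 'Z_m) (l : 'Z_s) : 'M[C]_s :=
  proj_mx <<wT i l>>%MS (\sum_(l' : 'Z_s | l' != l) <<wT i l'>>)%MS.

Definition QA : quiver :=
  @Quiver 'Z_m ('Z_m * 'Z_s)%type (fun x => x.1) (fun x => x.1 - rpow x.2).

Fixpoint QA_walk (i : 'Z_m) (qs : seq 'Z_s) : seq (arrow QA) :=
  if qs is q :: qs' then (i, q) :: QA_walk (i - rpow q) qs' else [::].

Lemma QA_walk_composable (i : vertex QA) (qs : seq 'Z_s) :
  composable i (QA_walk i qs).
Proof. by elim: qs i => [|q qs IH] i //=; rewrite eqxx IH. Qed.

Lemma QA_walk_size (i : 'Z_m) (sigma : {perm 'Z_s}) :
  size (QA_walk i (codom sigma)) == s.
Proof.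
have -> qs : size (QA_walk i qs) = size qs by elim: qs i => //= q qs IH i; rewrite IH.
by rewrite size_codom card_ord Zp_cast // prime_gt1 // s_prime.
Qed.

(* codom sigma lists sigma 0, ..., sigma (s - 1). *)
Definition QA_path (i : 'Z_m) (sigma : {perm 'Z_s}) : qpath QA s :=
  @QPath QA s (i, Tuple (QA_walk_size i sigma)) (QA_walk_composable i (codom sigma)).

Definition omegaA : path_comb C QA s :=
  [ffun p => \sum_(i : 'Z_m) \sum_(sigma : {perm 'Z_s})
               (-1) ^+ sigma * (p == QA_path i sigma)%:R].

(* (i, None) is the vertex i, (i, Some l) is the vertex i^(l). *)
Definition QG_vertex : finType :=
  {u : 'Z_m * option 'Z_s | (u.1 \in D) && (isSome u.2 == (u.1 \in F))}.

(* The label (p, a) yields an arrow from the T-summand over i to the one over j. *)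
Definition arrow_cond (i j : 'Z_m) (p a : 'Z_s) : bool :=
  [&& rpow a * j == i - rpow p,
      ~~ ((i \in F) && (j \in F)) &
      ((i \in F) || (j \in F)) ==> (a == 0)].

Definition QG_arrow : finType :=
  {b : QG_vertex * ('Z_s * 'Z_s) * QG_vertex
     | arrow_cond (val b.1.1).1 (val b.2).1 b.1.2.1 b.1.2.2}.

Definition QG : quiver :=
  @Quiver QG_vertex QG_arrow (fun b => (val b).1.1) (fun b => (val b).2).

(* The irreducible representation at u is the row space of SG u in T_i, where i
   lies under u. *)
Definition base (u : vertex QG) : 'Z_m := (val u).1.

Definition SG (u : vertex QG) : 'M[C]_s :=
  if (val u).2 is Some l then <<wT (base u) l>>%MS else 1%:M.

Definition projG (u : vertex QG) : 'M[C]_s :=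
  if (val u).2 is Some l then projT (base u) l else 1%:M.

(* V (x) T is represented by s x s matrices, x (x) y being x^T y; row k is the
   component along the k-th basis vector of V. *)
Definition tens (x y : 'rV[C]_s) : 'M[C]_s := x^T *m y.

(* The G-map T_i -> V (x) T_j such that v_i |-> beta^p v_1 (x) beta^a v_j, hence
   beta^k v_i |-> beta^k (beta^p v_1 (x) beta^a v_j). *)
Definition homT (j : 'Z_m) (p a : 'Z_s) (x : 'rV[C]_s) : 'M[C]_s :=
  \sum_(k < s) x 0 k *:
    tens (vT *m betaV ^+ p *m betaV ^+ k) (vT *m betaT j ^+ a *m betaT j ^+ k).

Definition arrow_map (b : arrow QG) (x : 'rV[C]_s) : 'M[C]_s :=
  homT (base (target b)) (val b).1.2.1 (val b).1.2.2 x *m projG (target b).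

(* The composite S_1 -> V (x) S_2 -> ... -> V^(x n) (x) S_(n+1) along a path of
   length n: the value at [k_1; ...; k_n] is the coefficient in S_(n+1) of
   e_(k_1) (x) ... (x) e_(k_n). *)
Fixpoint path_map (bs : seq (arrow QG)) (x : 'rV[C]_s) (ks : seq 'I_s) : 'rV[C]_s :=
  match bs, ks with
  | [::], [::] => x
  | b :: bs', k :: ks' => path_map bs' (row k (arrow_map b x)) ks'
  | _, _ => 0
  end.

(* e_(k_1) /\ ... /\ e_(k_s) as a multiple of e_1 /\ ... /\ e_s. *)
Definition wedge (ks : s.-tuple 'I_s) : C :=
  \det (\matrix_(i < s, j < s) (tnth ks i == j)%:R).

(* Followed by the antisymmetrizer, in det_V (x) S_(s+1) = S_(s+1). *)
Definition wedge_map (p : qpath QG s) (x : 'rV[C]_s) : 'rV[C]_s :=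
  \sum_(ks : s.-tuple 'I_s) wedge ks *: path_map (path_arrows p) x ks.

(* An identification of every det_V (x) S_v with an element S_(tau v) of Irr(G):
   G-isomorphisms S_(tau v) -> det_V (x) S_v. *)
Record det_identification := DetIdentification {
  tau : vertex QG -> vertex QG;
  theta : vertex QG -> 'M[C]_s;
  theta_image : forall v, (SG (tau v) *m theta v == SG v)%MS;
  theta_rank : forall v, \rank (SG (tau v)) = \rank (SG v);
  theta_alpha : forall v,
    SG (tau v) *m alphaT (base (tau v)) *m theta v =
    \det alphaV *: (SG (tau v) *m theta v *m alphaT (base v));
  theta_beta : forall v,
    SG (tau v) *m betaT (base (tau v)) *m theta v =
    \det betaV *: (SG (tau v) *m theta v *m betaT (base v)) }.

(* The scalar c_p: by Schur's lemma the composite S_u -> det_V (x) S_v is a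
   unique multiple of the identification if S_u is isomorphic to det_V (x) S_v,
   and is 0 otherwise. *)
Definition path_scalar (I : det_identification) (p : qpath QG s) : C :=
  let u := path_start p in
  let v := path_end p in
  if u == tau I v then
    xget 0 [set c : C | forall x : 'rV[C]_s, (x <= SG u)%MS ->
                          wedge_map p x = c *: (x *m theta I v)]
  else 0.

Definition omegaG (I : det_identification) : path_comb C QG s :=
  [ffun p => path_scalar I p * (\rank (SG (path_end p)))%:R].

Definition tQG_vertex : finType := {i : 'Z_m | i \in D}.

Definition tQG_arrow : finType :=
  {b : tQG_vertex * ('Z_s * 'Z_s) * tQG_vertex
     | arrow_cond (val b.1.1) (val b.2) b.1.2.1 b.1.2.2}.

Definition tQG : quiver :=
  @Quiver tQG_vertex tQG_arrow (fun b => (val b).1.1) (fun b => (val b).2).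

(* The representative of the orbit of i. *)
Definition under (i : 'Z_m) : 'Z_m :=
  odflt i [pick d in D | [exists k : 'Z_s, rpow k * d == i]].

Definition kappa (i : 'Z_m) : 'Z_s :=
  if i \in F then 0 else odflt 0 [pick k : 'Z_s | rpow k * under i == i].

Definition Phi_label (i : 'Z_m) (q : 'Z_s) : 'Z_s * 'Z_s :=
  let j := i - rpow q in
  if under i \in F then (q - kappa j, 0)
  else (q - kappa i, if under j \in F then 0 else kappa j - kappa i).

Lemma m_gt1 : (1 < m)%N.
Proof.
have := m_gt0 X; have := @r_neq1 _ X; case: (Defs.m X) => [|[|n]] //.
by rewrite !modn1.
Qed.

Lemma s_gt1 : (1 < s)%N. Proof. by rewrite prime_gt1 // s_prime. Qed.

Lemma r_expZ : (r%:R : 'Z_m) ^+ s = 1.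
Proof.
rewrite -natrX; apply: val_inj; rewrite /= !val_Zp_nat ?m_gt1 //.
by rewrite (r_exp_s X) modn_small ?m_gt1 // Zp_cast ?m_gt1 ?modn_small ?m_gt1.
Qed.

Lemma r_exp_mod (n : nat) :
  (r%:R : 'Z_m) ^+ (n %% (Zp_trunc s).+2) = r%:R ^+ n.
Proof.
rewrite (_ : (Zp_trunc s).+2 = s); last by rewrite Zp_cast // s_gt1.
by rewrite [in RHS](divn_eq n s) exprD mulnC exprM r_expZ expr1n mul1r.
Qed.

Lemma rpowD (k l : 'Z_s) : rpow (k + l) = rpow k * rpow l.
Proof. by rewrite /rpow -exprD -[RHS]r_exp_mod. Qed.

Lemma rpow0 : rpow 0 = 1. Proof. by []. Qed.

Lemma rpowB (k l : 'Z_s) : rpow (k - l) * rpow l = rpow k.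
Proof. by rewrite -rpowD subrK. Qed.

Lemma fixed_rpow (i : 'Z_m) (k : 'Z_s) : i \in F -> rpow k * i = i.
Proof.
rewrite inE => /eqP ri; rewrite /rpow; elim: (nat_of_ord k) => [|n IH].
  by rewrite mul1r.
by rewrite exprSr -mulrA ri.
Qed.

Lemma rpow_fixed (i : 'Z_m) (k : 'Z_s) : (rpow k * i \in F) = (i \in F).
Proof.
have fr (j : 'Z_m) l : j \in F -> rpow l * j \in F by move=> jF; rewrite fixed_rpow.
apply/idP/idP; last exact: fr.
by move/(fr _ (- k)); rewrite mulrA -rpowD addNr rpow0 mul1r.
Qed.

Lemma under_spec (i : 'Z_m) : under i \in D /\ exists k : 'Z_s, rpow k * under i = i.
Proof.
rewrite /under; case: pickP => [d /andP[dD /existsP[k /eqP e]]|no] /=.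
  by split=> //; exists k.
have [d [[dD [k e]] _]] := @reps_transversal _ X i.
have := no d; rewrite /= dD /=; case/existsP; exists (inZp k).
by rewrite /rpow /= r_exp_mod -e.
Qed.

Lemma under_reps (i : 'Z_m) : under i \in D. Proof. by have [] := under_spec i. Qed.

Lemma under_fixed (i : 'Z_m) : (under i \in F) = (i \in F).
Proof. by have [_ [k {2}<-]] := under_spec i; rewrite rpow_fixed. Qed.

Lemma kappaP (i : 'Z_m) : rpow (kappa i) * under i = i.
Proof.
have [_ [k e]] := under_spec i; rewrite /kappa; case: ifP => [iF|_].
  by rewrite -[in RHS]e !fixed_rpow // under_fixed.
by case: pickP => [l /eqP //|/(_ k)]; rewrite e eqxx.
Qed.

Lemma rpowNK (k : 'Z_s) (x : 'Z_m) : rpow (- k) * (rpow k * x) = x.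
Proof. by rewrite mulrA -rpowD addNr mul1r. Qed.

Lemma not_both_fixed (i : 'Z_m) (q : 'Z_s) : i \in F -> i - rpow q \notin F.
Proof.
rewrite inE => /eqP ri; apply/negP; rewrite inE mulrBr ri => /eqP /addrI /oppr_inj e.
have r1 : (r%:R : 'Z_m) = 1.
  by rewrite -[LHS](rpowNK q) (mulrC (rpow q)) e -[X in _ * X]mulr1 rpowNK.
apply: (@r_neq1 _ X); move/(congr1 val): r1.
by rewrite /= val_Zp_nat ?m_gt1 // => ->; rewrite modn_small ?Zp_cast ?modn_small ?m_gt1.
Qed.

Lemma Phi_arrow_cond (i : 'Z_m) (q : 'Z_s) (l := Phi_label i q) :
  arrow_cond (under i) (under (i - rpow q)) l.1 l.2.
Proof.
rewrite /arrow_cond /l /Phi_label !under_fixed.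
have e := kappaP (i - rpow q); set j := i - rpow q in e *.
have [iF|iF] /= := boolP (i \in F).
  have jF := not_both_fixed q iF; rewrite -/j in jF.
  have ui : under i = i by rewrite -[RHS]kappaP fixed_rpow // under_fixed.
  rewrite jF eqxx !andbT mul1r ui -(rpowNK (kappa j) (under j)) e /j mulrBr.
  by rewrite fixed_rpow // -rpowD (addrC q).
have ui : under i = rpow (- kappa i) * i by rewrite -[X in _ * X](kappaP i) rpowNK.
have [jF|jF] /= := boolP (j \in F).
  have uj : under j = j by rewrite -[RHS]kappaP fixed_rpow // under_fixed.
  rewrite eqxx andbT mul1r ui uj.
  by rewrite -(fixed_rpow (- kappa i) jF) /j mulrBr -rpowD (addrC q).
by rewrite andbT ui (addrC (kappa j)) (rpowD _ (kappa j)) -mulrA e /j mulrBr -rpowD (addrC q).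
Qed.

Definition Phi_vertex (i : vertex QA) : vertex tQG := Sub (under i) (under_reps i).

Definition Phi_arrow (x : arrow QA) : arrow tQG :=
  Sub (Phi_vertex x.1, Phi_label x.1 x.2, Phi_vertex (x.1 - rpow x.2))
      (Phi_arrow_cond x.1 x.2).

Definition Phi : quiver_morphism QA tQG :=
  @QuiverMorphism QA tQG Phi_vertex Phi_arrow
    (fun=> erefl) (fun=> erefl).

End Metacyclic.

(* Main.v *)
(** On weight bases, the composite map along a path of [QG] expands into terms
    indexed by walks of [QA] lying over that path through [Phi]: the vector
    [beta^k v_i] has weight [r^k i], an arrow labelled [(p, a)] sends it to
    [beta^(p + k) v_1 (x) beta^(a + k) v_j], which is the arrow of type [p + k]
    of [QA] at [r^k i], and the projection onto a summand over a fixed residue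
    does not change the weight. After antisymmetrizing, only walks whose arrow
    types form a permutation survive, and these occur in [omegaA]. Hence [QG]
    can be graded by giving each arrow the common [gA]-degree of the arrows
    of [QA] over it. *)
Require Import Defs.
From mathcomp Require Import all_boot all_order all_fingroup all_algebra.
From mathcomp Require Import classical_sets.

Set Implicit Arguments.
Unset Strict Implicit.
Unset Printing Implicit Defensive.

Local Open Scope ring_scope.

Import GRing.Theory.

Lemma sum_neq0_exists (V : nmodType) (J : finType) (f : J -> V) :
  \sum_j f j != 0 -> exists j, f j != 0.
Proof.
move=> fN0; apply/existsP; apply: contraNT fN0; rewrite negb_exists => /forallP f0.
by rewrite big1 // => j _; apply/eqP; rewrite -[_ == _]negbK f0.
Qed.

Section Metacyclic.

Context (C : fieldType) (X : metacyclic C).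

Local Notation m := (m X).
Local Notation s := (s X).
Local Notation F := (fixed_residues m (r X)).
Local Notation rpow := (rpow (X := X)).

Lemma Zs_card : (Zp_trunc s).+2 = s.
Proof. by rewrite Zp_cast // s_gt1. Qed.

(** Matrix indices lie in ['I_s] and arrow labels in ['Z_s]; their bounds agree only up to the
    propositional equality [Zs_card], hence the cast. *)
Definition ordZ (k : 'I_s) : 'Z_s := cast_ord (esym Zs_card) k.

Lemma ordZ_inj : injective ordZ. Proof. exact: cast_ord_inj. Qed.

Lemma ordZE (k : 'I_s) (n : nat) : val k = (n %% s)%N -> ordZ k = n%:R.
Proof. by move=> kn; apply: val_inj; rewrite /= val_Zp_nat ?s_gt1 -?kn. Qed.

(** As [s] is prime, a nonzero [k] is invertible modulo [s], so some power of [rpow k] is [r] itself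
    and [j] would be fixed by [r]. *)
Lemma rpow_free (k : 'Z_s) (j : 'Z_m) : j \notin F -> rpow k * j = j -> k = 0.
Proof.
move=> jF kj; apply: contraNeq jF => k0; rewrite inE.
have kn n : rpow k ^+ n * j = j.
  by elim: n => [|n IH]; rewrite ?mul1r // exprSr -mulrA kj.
have k_gt0 : (0 < k)%N by rewrite lt0n; apply: contraNneq k0 => e; apply/eqP/val_inj.
have cks : coprime k s.
  rewrite coprime_sym prime_coprime ?s_prime // gtnNdvd //.
  by rewrite -[X in (_ < X)%N]Zs_card.
have [u v e _] := egcdnP s k_gt0.
have {}e : (u * k)%N = (v * s + 1)%N by rewrite e (eqP cks).
have <- : rpow k ^+ u = (Defs.r X)%:R.
  by rewrite /Defs.rpow -exprM mulnC e exprD mulnC exprM r_expZ expr1n mul1r.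
by rewrite kn.
Qed.

Lemma under_rpow (k : 'Z_s) (i : 'Z_m) : under (rpow k * i) = under i.
Proof.
have [d [_ dU]] := @reps_transversal _ X (rpow k * i).
rewrite -[LHS]dU -1?[RHS]dU //.
  split; first exact: under_reps.
  have [_ [l e]] := under_spec (X := X) i.
  by exists (val (k + l)); rewrite -[in LHS]e mulrA -rpowD.
split; first exact: under_reps.
by have [_ [l {1}<-]] := under_spec (X := X) (rpow k * i); exists (val l).
Qed.

(** Both exponents carry the common representative to [rpow k * j], so their difference stabilizes a
    non-fixed residue and vanishes by [rpow_free]. *)
Lemma kappa_rpow (k : 'Z_s) (j : 'Z_m) :
  j \notin F -> kappa (rpow k * j) = kappa j + k.
Proof.
move=> jF; apply/eqP; rewrite -subr_eq0; apply/eqP.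
apply: (@rpow_free _ (rpow k * j)); first by rewrite rpow_fixed.
have e1 : rpow k * j = rpow (kappa j + k) * under j.
  by rewrite (addrC (kappa j)) rpowD -mulrA kappaP.
have e2 : rpow (kappa (rpow k * j)) * under j = rpow k * j.
  by rewrite -(under_rpow k) kappaP.
by rewrite {2}e1 mulrA rpowB e2.
Qed.

(** The labels of [Phi] are differences of terms that all shift by [k]. *)
Lemma Phi_arrow_rpow (k q : 'Z_s) (i : 'Z_m) :
  Phi_arrow (X := X) (rpow k * i, q + k) = Phi_arrow (X := X) (i, q).
Proof.
have ej : rpow k * i - rpow (q + k) = rpow k * (i - rpow q).
  by rewrite mulrBr (addrC q) rpowD.
apply: val_inj; rewrite /= ej; congr (_, _, _).
- by apply: val_inj; rewrite /= under_rpow.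
- rewrite /Phi_label ej !under_rpow !under_fixed.
  have [iF|iF] := boolP (i \in F).
    by rewrite kappa_rpow ?not_both_fixed // opprD addrACA subrr addr0.
  rewrite kappa_rpow // opprD addrACA subrr addr0; case: ifP => // jF.
  by rewrite kappa_rpow ?jF // addrACA subrr addr0.
- by apply: val_inj; rewrite /= under_rpow.
Qed.

(** One arrow of [QA] is chosen in each class under simultaneous shifts; gradability makes the
    choice harmless. *)
Definition pull_grading (gA : grading (QA X)) : grading (QG X) :=
  fun b => gA (base (source b), (val b).1.2.1).

Lemma mul_betaT_support (i : 'Z_m) (n : nat) (x : 'rV[C]_s) (k : 'I_s) :
  (x *m betaT i ^+ n) 0 k != 0 ->
  exists2 l : 'I_s, x 0 l != 0 & val k = ((l + n) %% s)%N.
Proof.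
elim: n k => [|n IH] k.
  by rewrite expr0 mulmx1 => xk; exists k; rewrite // addn0 modn_small.
rewrite exprSr -mulmxE mulmxA mxE => /sum_neq0_exists[h].
rewrite mulf_eq0 negb_or => /andP[/IH[l xl hl] bhk]; exists l => //.
rewrite addnS -addn1 -modnDml -hl addn1; move: bhk; rewrite mxE.
(* The last basis vector wraps around to the first one, up to a root of unity. *)
case: ifP => [/eqP -> | hs].
  by rewrite modnn; case: (val k =P 0%N) => // _; rewrite mul0r eqxx.
case: (val k =P h.+1) => [-> _ | _]; last by rewrite eqxx.
by rewrite modn_small // ltn_neqAle hs ltn_ord.
Qed.

Lemma vT_betaT_support (i : 'Z_m) (n k : nat) (h : 'I_s) :
  (vT X *m betaT i ^+ n *m betaT i ^+ k) 0 h != 0 ->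
  ordZ h = n%:R + k%:R.
Proof.
move=> /mul_betaT_support[l /mul_betaT_support[o]].
rewrite mxE; case: (val o =P 0%N) => [-> _ ln hl|_]; last by rewrite eqxx.
by rewrite -natrD; apply: ordZE; rewrite hl ln modnDml.
Qed.

Lemma arrow_map_support (b : arrow (QG X)) (x : 'rV[C]_s) (h k' : 'I_s) :
  arrow_map b x h k' != 0 ->
  exists k : 'I_s, [/\ x 0 k != 0,
    ordZ h = (val b).1.2.1 + ordZ k &
    rpow (ordZ k) * base (source b) - rpow (ordZ h) =
      rpow (ordZ k') * base (target b)].
Proof.
rewrite /arrow_map mxE => /sum_neq0_exists[l].
rewrite mulf_eq0 negb_or => /andP[]; rewrite summxE => /sum_neq0_exists[k].
rewrite mxE mulf_eq0 negb_or => /andP[xk]; rewrite mxE big_ord1 mxE.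
rewrite mulf_eq0 negb_or => /andP[/vT_betaT_support eh /vT_betaT_support el] lk'.
have kZ : (val k)%:R = ordZ k by rewrite (@ordZE k k) // modn_small.
rewrite kZ natr_Zp in eh; rewrite kZ natr_Zp in el.
exists k; split=> //.
have cond : rpow (val b).1.2.2 * base (target b) =
    base (source b) - rpow (val b).1.2.1.
  by have /and3P[/eqP] := valP b : arrow_cond _ _ _ _.
rewrite eh (addrC _ (ordZ k)) rpowD -mulrBr -cond mulrA -rpowD (addrC _ (val b).1.2.2) -el.
(* Over a fixed residue the projection may mix basis vectors, but all of them have the same weight;
   elsewhere it is the identity and forces [l = k']. *)
move: lk'; rewrite /projG; case e: (val (target b)).2 => [o|].
  have bF : base (target b) \in F.
    by have /andP[_] := valP (target b); rewrite e /= => /eqP <-.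
  by rewrite !fixed_rpow.
by rewrite mxE; case: (l =P k') => [->//|_]; rewrite eqxx.
Qed.

(** Induction along the path: the coordinate [k'] that survives one arrow fixes the weight at which
    the rest of the walk starts. *)
Lemma path_map_walk (gA : grading (QA X)) (bs : seq (arrow (QG X)))
    (u : vertex (QG X)) (x : 'rV[C]_s) (ks : seq 'I_s) :
  gradable gA (Phi X) -> composable u bs -> Defs.path_map bs x ks != 0 ->
  exists k : 'I_s, x 0 k != 0 /\
    \sum_(b <- bs) pull_grading gA b =
    \sum_(y <- QA_walk (rpow (ordZ k) * base u) (map ordZ ks)) gA y.
Proof.
move=> grad; elim: bs u x ks => [|b bs IH] u x [|h ks] //=; rewrite ?eqxx //.
  move=> _ x0; have [k xk] : exists k, x 0 k != 0.
    by have /matrix0Pn[o [k]] := x0; rewrite ord1; exists k.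
  by exists k; rewrite !big_nil.
case/andP=> /eqP <- cb /(IH _ _ _ cb)[k' []]; rewrite mxE => /arrow_map_support.
case=> k [xk eh ew] IHe; exists k; split=> //.
rewrite !big_cons IHe -ew; congr (_ + _).
(* The arrow walked and the one chosen by [pull_grading] differ by a shift by [ordZ k], so they have
   the same image under [Phi]. *)
by apply: (grad _ _ _ erefl); rewrite /= eh; exact: Phi_arrow_rpow.
Qed.

(** A repeated index would give the determinant two equal rows. *)
Lemma wedge_perm (ks : s.-tuple 'I_s) :
  wedge ks != 0 -> exists sigma : {perm 'Z_s}, codom sigma = map ordZ ks.
Proof.
move=> wN0; pose f (k : 'Z_s) := ordZ (tnth ks (cast_ord Zs_card k)).
have f_inj : injective f.
  move=> k l /ordZ_inj ekl; apply/eqP; apply: contraNT wN0 => nkl.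
  apply/eqP/(@determinant_alternate _ _ _ (cast_ord Zs_card k) (cast_ord Zs_card l)).
    by rewrite (inj_eq (@cast_ord_inj _ _ _)).
  by move=> j; rewrite !mxE ekl.
exists (perm f_inj); apply: (@eq_from_nth _ 0).
  by rewrite size_codom card_ord size_map size_tuple Zs_card.
move=> n; rewrite size_codom card_ord => n_lt.
have n_lts : (n < s)%N by rewrite -Zs_card.
rewrite (nth_map 0) ?size_enum_ord // permE /f.
rewrite (nth_map (tnth ks (Ordinal n_lts))) ?size_tuple //; congr ordZ.
by rewrite (tnth_nth (tnth ks (Ordinal n_lts))) /= nth_enum_ord.
Qed.

Lemma QA_walk_inj (i : 'Z_m) : injective (QA_walk (X := X) i).
Proof.
by move=> qs; elim: qs i => [|q qs IH] i [|q' qs'] //= [<- /IH ->].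
Qed.

(** Distinct pairs [(i, sigma)] give distinct paths, so nothing cancels in [omegaA]. *)
Lemma omegaA_QA_path (i : 'Z_m) (sigma : {perm 'Z_s}) :
  omegaA X (QA_path i sigma) = (-1) ^+ sigma.
Proof.
rewrite ffunE (bigD1 i) //= (bigD1 sigma) //= eqxx mulr1 !big1 ?addr0 //.
  move=> j jNi; apply: big1 => tau _; case: eqP => [e|_]; last by rewrite mulr0.
  by case/eqP: jNi; move/(congr1 (@path_start _ _)): e.
move=> tau tauN; case: eqP => [e|_]; last by rewrite mulr0.
case/eqP: tauN; apply/permP=> k.
move/(congr1 (fun p => val (path_arrows p))): e => /QA_walk_inj.
by move/eq_in_map/(_ k); rewrite mem_enum => ->.
Qed.

(** A nonzero coefficient rules out the default value of [xget], and its rank factor makes the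
    identification nonzero, so the wedge map is a nonzero multiple of a nonzero map. *)
Lemma omegaG_support (I : det_identification X) (p : qpath (QG X) s) :
  omegaG I p != 0 -> exists x, wedge_map p x != 0.
Proof.
rewrite ffunE mulf_eq0 negb_or => /andP[]; rewrite /path_scalar.
case: (path_start p =P _) => [eu|_]; last by rewrite eqxx.
case: xgetP => [c _ /= cP c0 rkN0|_]; last by rewrite eqxx.
have /andP[_ sub] := theta_image I (path_end p); rewrite eu in cP.
have /rowV0Pn[y /submxP[z ->] zN0] :
    SG (tau I (path_end p)) *m theta I (path_end p) != 0.
  apply: contraNneq rkN0 => e; move: sub.
  by rewrite e submx0 => /eqP ->; rewrite mxrank0.
exists (z *m SG (tau I (path_end p))); rewrite cP ?submxMl //.
by rewrite scaler_eq0 negb_or c0 -mulmxA.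
Qed.

Lemma pull_grading_homogeneous (I : det_identification X) (gA : grading (QA X))
    (a : int) :
  homogeneous gA (omegaA X) a -> gradable gA (Phi X) ->
  homogeneous (pull_grading gA) (omegaG I) a.
Proof.
move=> homA grad p /omegaG_support[x /sum_neq0_exists[ks]].
rewrite scaler_eq0 negb_or => /andP[/wedge_perm[sigma codom_sigma]].
move=> /(path_map_walk grad (path_composable p))[k [_ e]].
rewrite /path_degree /path_arrows e -codom_sigma.
by apply: (homA (QA_path _ sigma)); rewrite omegaA_QA_path signr_eq0.
Qed.

End Metacyclic.

Theorem proposition6p23 (R : realType) (X : metacyclic (complex R))
    (I : det_identification X) (gA : grading (QA X)) (a : int) :
  homogeneous gA (omegaA X) a ->
  gradable gA (Phi X) ->
  exists gG : grading (QG X), homogeneous gG (omegaG I) a.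
Proof.
by move=> homA grad; exists (pull_grading gA); apply: pull_grading_homogeneous.
Qed.
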